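(* Let $f:\mathbb{R}^n\to\mathbb{R}^n$ and $x^*\in\mathbb{R}^n$ with $f(x^* )=0$. Assume: $J_f(x^* )$ has a one-dimensional null space $\mathcal{N}=\mathrm{span}\{\phi\}$ and closed range $\mathcal{X}$ with $\mathbb{R}^n=\mathcal{N}\oplus\mathcal{X}$; $f$ is twice Lipschitz continuously differentiable in a neighborhood of $x^*$; and, with $P_\mathcal{N}$ the projection onto $\mathcal{N}$ parallel to $\mathcal{X}$, $P_\mathcal{N}H_f(x^* )(\phi,\phi)\neq 0$. Assume moreover that for every $x$ with $P_\mathcal{N}(x-x^* )\neq 0$ the linear map $\bar D_1(x):\mathcal{N}\to\mathcal{N}$, $\bar D_1(x)(z)=P_\mathcal{N}H_f(x^* )\big(P_\mathcal{N}(x-x^* ),P_\mathcal{N}z\big)$, is nonsingular. Let $\{x_j\}_j$ be iterates generated by an nlKrylov method (as in the context) and suppose there is a constant $c$ such that $\|t_j\|\le c\|f(x_j)\|^2$ for all $j$, where $t_j=J_f(x_j)(x_{j+1}-x_j)+f(x_j)$. Then for $\rho>0$ and $\gamma>0$ sufficiently small, $J_f(x_0)^{-1}$ exists for all $x_0\in W(\rho,\gamma)$, and the sequence $\{x_j\}_j$ converges to $x^*$ with $$\|P_\mathcal{X}(x_{j+1}-x^* )\|\le K_1\|x_j-x^*\|^2$$ for some constant $K_1>0$, and $$\lim_{j\to\infty}\frac{\|P_\mathcal{N}(x_{j+1}-x^* )\|}{\|P_\mathcal{N}(x_j-x^* )\|}=\frac12.$$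
   Context: Norms are Euclidean 2-norms; $J_f(x)$ is the Jacobian and $H_f(x)$ the Hessian (second derivative, a symmetric bilinear map $\mathbb{R}^n\times\mathbb{R}^n\to\mathbb{R}^n$) of $f$ at $x$. $P_\mathcal{X}=I-P_\mathcal{N}$. For $\rho,\gamma>0$, the region $W(\rho,\gamma)=\{x\in\mathbb{R}^n:\ 0<\|x-x^*\|<\rho,\ \|P_\mathcal{X}(x-x^* )\|\le\gamma\|P_\mathcal{N}(x-x^* )\|\}$. An nlKrylov method solves $f(x)=0$ as follows: at iteration $j$ it holds matrices $P_j,V_j\in\mathbb{R}^{n\times n_j}$ (search directions and approximations of $J_f(x_j)P_j$, built from previous iterates, Jacobian-vector products and an inner linear solver applied to $J_f(x_j)\hat p=-f(x_j)$), with $V_j^TV_j=I_{n_j}$; it sets $y_j=-V_j^Tf(x_j)$ and updates $x_{j+1}=x_j+P_jy_j$. The vector $t_j$ is the inexactness of this step viewed as an inexact Newton step. *)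

(* Defs.v *)
From HB Require Import structures.
From mathcomp Require Import all_boot all_order all_algebra.
From mathcomp Require Import all_classical all_reals all_analysis.
Set Implicit Arguments. Unset Strict Implicit. Unset Printing Implicit Defensive.
Import Order.TTheory GRing.Theory Num.Theory.
Local Open Scope ring_scope.

Section Defs.
Variables (R : realType) (n : nat).

Definition enorm (v : 'cV[R]_n) : R := Num.sqrt (\sum_i (v i 0) ^+ 2).

(* The symmetric bilinear map R^n x R^n -> R^n represented by the n Hessian
   matrices T i (T i = Hessian of the i-th component):  (u,v) |-> (u^T T_i v)_i *)
Definition hessB (T : 'I_n -> 'M[R]_n) (u v : 'cV[R]_n) : 'cV[R]_n :=
  \col_i ((u^T *m T i *m v) 0 0).

Definition jacobian_at (f : 'cV[R]_n -> 'cV[R]_n) (A : 'M[R]_n) (x : 'cV[R]_n) :=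
  forall eps : R, 0 < eps -> exists2 d : R, 0 < d &
    forall y, enorm (y - x) < d ->
      enorm (f y - f x - A *m (y - x)) <= eps * enorm (y - x).

(* T is the (Frechet) derivative of the Jacobian map J at x, i.e. the Hessian
   of f at x, with H(x)(h,v) = (DJ(x)[h]) v  (operator-norm estimate) *)
Definition hessian_at (J : 'cV[R]_n -> 'M[R]_n) (T : 'I_n -> 'M[R]_n)
  (x : 'cV[R]_n) :=
  forall eps : R, 0 < eps -> exists2 d : R, 0 < d &
    forall y, enorm (y - x) < d -> forall v,
      enorm ((J y - J x) *m v - hessB T (y - x) v) <= eps * enorm (y - x) * enorm v.

Definition inW (xs : 'cV[R]_n) (PN : 'M[R]_n) (rho gam : R) (x : 'cV[R]_n) :=
  0 < enorm (x - xs) < rho /\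
  enorm ((1%:M - PN) *m (x - xs)) <= gam * enorm (PN *m (x - xs)).

Definition nlkrylov_step (f : 'cV[R]_n -> 'cV[R]_n) (m : nat)
  (P V : 'M[R]_(n, m)) (xj xj1 : 'cV[R]_n) :=
  V^T *m V = 1%:M /\ xj1 = xj + P *m (- (V^T *m f xj)).

End Defs.

(* Main.v *)
(** Write e = x - xs, a = PN e, b = (1 - PN) e.  In the wedge |b| <= gam |a|,
    the Hessian condition on N gives |e| |v| <= M |J(x) v|, and the component of v
    along the range X satisfies the stronger bound |v_X| <= M' |J(x) v|: only the
    null-space component of J(x)^-1 blows up, like 1/|e|.  In particular J(x) is
    invertible.  Applied to v = (x+ - xs) - a/2, for which the linear and quadratic
    Taylor terms cancel so that |J(x) v| = O(|e| (|b| + |e|^2)), this yields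
    |b+| = O(|e|^2) and |a+ - a/2| = O(|b| + |e|^2).  Hence the wedge is invariant,
    the errors decay geometrically, and |a+|/|a| tends to 1/2. *)

Require Import Defs.
From HB Require Import structures.
From mathcomp Require Import all_boot all_order all_algebra.
From mathcomp Require Import all_classical all_reals all_analysis.
From mathcomp Require Import ring lra.
Import Order.TTheory GRing.Theory Num.Theory.
Import numFieldNormedType.Exports.
Local Open Scope classical_set_scope.
Local Open Scope ring_scope.

(** * The Euclidean norm, and boundedness of linear and bilinear maps *)

Section EuclideanNorm.
Variables (R : realType) (n : nat).
Implicit Types u v : 'cV[R]_n.

Lemma enorm_ge0 v : 0 <= enorm v.
Proof. exact: sqrtr_ge0. Qed.

Lemma enorm_sqr v : enorm v ^+ 2 = \sum_i v i 0 ^+ 2.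
Proof. by rewrite sqr_sqrtr // sumr_ge0 // => i _; rewrite sqr_ge0. Qed.

Lemma abs_coord_le_enorm v i : `|v i 0| <= enorm v.
Proof.
rewrite -ler_sqr ?nnegrE ?enorm_ge0 // enorm_sqr real_normK ?num_real //.
by rewrite (bigD1 i) //= lerDl sumr_ge0 // => j _; rewrite sqr_ge0.
Qed.

Lemma enorm0 : enorm (0 : 'cV[R]_n) = 0.
Proof. by rewrite /enorm big1 ?sqrtr0 // => i _; rewrite mxE expr0n. Qed.

Lemma enorm_eq0 v : (enorm v == 0) = (v == 0).
Proof.
apply/eqP/eqP => [v0|->]; last exact: enorm0.
apply/matrixP => i j; rewrite ord1 mxE; apply/normr0_eq0/le_anti.
by rewrite normr_ge0 -v0 abs_coord_le_enorm.
Qed.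

Lemma enormZ (a : R) v : enorm (a *: v) = `|a| * enorm v.
Proof.
rewrite /enorm -sqrtr_sqr -sqrtrM ?sqr_ge0 // mulr_sumr.
by congr Num.sqrt; apply: eq_bigr => i _; rewrite mxE exprMn.
Qed.

Lemma enormN v : enorm (- v) = enorm v.
Proof. by rewrite -scaleN1r enormZ normrN1 mul1r. Qed.

Lemma enormB_sym u v : enorm (u - v) = enorm (v - u).
Proof. by rewrite -opprB enormN. Qed.

Lemma enormD u v : enorm (u + v) <= enorm u + enorm v.
Proof.
have [->|u0] := eqVneq u 0; first by rewrite add0r enorm0 add0r.
have [->|v0] := eqVneq v 0; first by rewrite addr0 enorm0 addr0.
have pu : 0 < enorm u by rewrite lt_def enorm_eq0 u0 enorm_ge0.
have pv : 0 < enorm v by rewrite lt_def enorm_eq0 v0 enorm_ge0.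
rewrite -ler_sqr ?nnegrE ?addr_ge0 ?enorm_ge0 // enorm_sqr.
(* Weighted AM-GM: [2 s t <= k s^2 + k^-1 t^2] termwise. *)
set k := enorm v / enorm u.
have pk : 0 < k by rewrite divr_gt0.
have -> : (enorm u + enorm v) ^+ 2 =
    (1 + k) * enorm u ^+ 2 + (1 + k^-1) * enorm v ^+ 2.
  by rewrite /k; field; rewrite !gt_eqF.
rewrite !enorm_sqr !mulr_sumr -big_split /=; apply: ler_sum => i _.
rewrite mxE -subr_ge0.
have -> : (1 + k) * u i 0 ^+ 2 + (1 + k^-1) * v i 0 ^+ 2 - (u i 0 + v i 0) ^+ 2
    = k^-1 * (k * u i 0 - v i 0) ^+ 2 by field; rewrite gt_eqF.
by rewrite mulr_ge0 ?sqr_ge0 // invr_ge0 ltW.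
Qed.

Lemma enormB u v : enorm (u - v) <= enorm u + enorm v.
Proof. by rewrite (le_trans (enormD _ _)) // enormN. Qed.

Lemma enorm_distD u v : `|enorm u - enorm v| <= enorm (u - v).
Proof.
have h1 := enormD (u - v) v; have h2 := enormD (v - u) u.
rewrite subrK in h1; rewrite subrK (enormB_sym v) in h2.
rewrite ler_norml; apply/andP; split; lra.
Qed.

(** The factor [n] is crude but harmless: every constant below only has to exist. The lemma serves
    to reassemble vector bounds from coordinatewise ones. *)
Lemma enorm_le_coord v (B : R) :
  (forall i, `|v i 0| <= B) -> enorm v <= n%:R * B.
Proof.
(* For [n = 0] nothing forces [B] to be nonnegative, but both sides vanish. *)
move=> hB; case: n v hB => [|m] v hB.
  by rewrite /enorm big_ord0 sqrtr0 mul0r.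
have B0 : 0 <= B := le_trans (normr_ge0 _) (hB ord0).
rewrite -ler_sqr ?nnegrE ?sqrtr_ge0 ?mulr_ge0 ?ler0n //.
rewrite /enorm sqr_sqrtr ?sumr_ge0 // => [|i _]; last by rewrite sqr_ge0.
apply: (@le_trans _ _ (\sum_(i < m.+1) B ^+ 2)).
  by apply: ler_sum => i _; rewrite -real_normK ?num_real // ler_sqr ?nnegrE.
rewrite sumr_const card_ord exprMn -[X in X <= _]mulr_natl.
by rewrite ler_wpM2r ?sqr_ge0 // -natrX ler_nat expnS leq_pmulr.
Qed.

Lemma mulmx_bounded (A : 'M[R]_n) :
  exists C : R, forall v, enorm (A *m v) <= C * enorm v.
Proof.
exists (n%:R * \sum_i \sum_j `|A i j|) => v; rewrite -mulrA.
apply: enorm_le_coord => i; rewrite mxE [X in _ <= X * _](bigD1 i) //= mulrDl mulr_suml.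
apply: (le_trans (ler_norm_sum _ _ _)); rewrite -[X in X <= _]addr0.
apply: lerD; last first.
  by rewrite mulr_ge0 ?enorm_ge0 // sumr_ge0 // => k _; rewrite sumr_ge0.
by apply: ler_sum => j _; rewrite normrM ler_wpM2l // abs_coord_le_enorm.
Qed.

Lemma hessB_bounded (T : 'I_n -> 'M[R]_n) :
  exists C : R, forall u v, enorm (hessB T u v) <= C * enorm u * enorm v.
Proof.
pose C := \sum_i \sum_j \sum_k `|T i k j|.
exists (n%:R * C) => u v; rewrite -!mulrA.
apply: enorm_le_coord => i; rewrite !mxE /C [X in _ <= X * _](bigD1 i) //= mulrDl mulr_suml.
apply: (le_trans (ler_norm_sum _ _ _)); rewrite -[X in X <= _]addr0.
apply: lerD; last first.
  rewrite !mulr_ge0 ?enorm_ge0 // sumr_ge0 // => k _.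
  by rewrite sumr_ge0 // => l _; rewrite sumr_ge0.
apply: ler_sum => j _; rewrite mxE normrM mulrA.
apply: ler_pM => //; last exact: abs_coord_le_enorm.
rewrite mulr_suml (le_trans (ler_norm_sum _ _ _)) //.
apply: ler_sum => k _; rewrite mxE normrM mulrC ler_wpM2l //.
exact: abs_coord_le_enorm.
Qed.

Lemma PN_PX_split (PN : 'M[R]_n) v : PN *m v + (1%:M - PN) *m v = v.
Proof. by rewrite mulmxBl mul1mx addrC subrK. Qed.

End EuclideanNorm.

(** * Bilinearity of the Hessian map *)

Section HessianMap.
Variables (R : realType) (n : nat) (T : 'I_n -> 'M[R]_n).

Lemma hessBE u v i : hessB T u v i 0 = (u^T *m T i *m v) 0 0.
Proof. by rewrite mxE. Qed.

Lemma hessBDl u1 u2 v : hessB T (u1 + u2) v = hessB T u1 v + hessB T u2 v.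
Proof.
apply/matrixP => i j; rewrite ord1 hessBE linearD /= !mulmxDl.
by rewrite mxE [RHS]mxE !hessBE.
Qed.

Lemma hessBDr u v1 v2 : hessB T u (v1 + v2) = hessB T u v1 + hessB T u v2.
Proof.
by apply/matrixP => i j; rewrite ord1 hessBE mulmxDr mxE [RHS]mxE !hessBE.
Qed.

Lemma hessBZl a u v : hessB T (a *: u) v = a *: hessB T u v.
Proof.
apply/matrixP => i j; rewrite ord1 hessBE linearZ /= -!scalemxAl.
by rewrite mxE [RHS]mxE hessBE.
Qed.

Lemma hessBZr a u v : hessB T u (a *: v) = a *: hessB T u v.
Proof.
by apply/matrixP => i j; rewrite ord1 hessBE -scalemxAr mxE [RHS]mxE hessBE.
Qed.

End HessianMap.

(** * A mean value inequality for vector-valued curves *)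

Section MeanValue.
Variable R : realType.

(** Bridge from the epsilon-delta differentiability of [jacobian_at] and [hessian_at] to the
    derivative required by the mean value theorem. *)
Lemma is_derive_of_approx (s : R -> R) (ds t : R) :
  (forall eps : R, 0 < eps -> exists2 d : R, 0 < d &
     forall y : R, `|y - t| < d -> `|s y - s t - ds * (y - t)| <= eps * `|y - t|) ->
  is_derive t (1 : R) s ds.
Proof.
move=> hs.
have cvg_ds : h^-1 *: ((s \o shift t) (h *: (1 : R)) - s t) @[h --> 0^'] --> ds.
  apply/cvgrPdist_le => eps /hs [d d0 hd]; near=> h.
  have h0 : h != 0 by near: h; exact: nbhs_dnbhs_neq.
  have hh : `|h| < d by near: h; apply: dnbhs0_lt.
  have := hd (h + t); rewrite addrK => /(_ hh) hle.
  rewrite /= /shift /= -[h *: 1]/(h * 1) mulr1.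
  rewrite -[_ *: _]/(h^-1 * (s (h + t) - s t)) distrC.
  have -> : h^-1 * (s (h + t) - s t) - ds = h^-1 * (s (h + t) - s t - ds * h).
    by field.
  by rewrite normrM normfV ler_pdivrMl ?normr_gt0 // [`|h| * _]mulrC.
split; first by apply/cvg_ex; exists ds.
exact: (cvg_lim _ cvg_ds).
Unshelve. all: by end_near.
Qed.

(** The scalar mean value theorem is applied to each coordinate, with an intermediate point that
    depends on the coordinate; reassembling the coordinates costs the factor [n]. *)
Lemma mean_value_ineq (n : nat) (g dg : R -> 'cV[R]_n) (B : R) :
  (forall t : R, 0 <= t <= 1 -> forall eps : R, 0 < eps -> exists2 d : R, 0 < d &
     forall y : R, `|y - t| < d ->
       enorm (g y - g t - (y - t) *: dg t) <= eps * `|y - t|) ->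
  (forall t : R, 0 <= t <= 1 -> enorm (dg t) <= B) ->
  enorm (g 1 - g 0) <= n%:R * B.
Proof.
move=> hg hB; apply: enorm_le_coord => i.
have der (t : R) : 0 <= t <= 1 -> is_derive t (1 : R) (fun t : R => g t i 0) (dg t i 0).
  move=> t01; apply: is_derive_of_approx => eps /(hg t t01)[d d0 hd].
  exists d => // y /hd; apply: le_trans.
  by have := abs_coord_le_enorm _ _ (g y - g t - (y - t) *: dg t) i; rewrite !mxE mulrC.
have [||c c01] := @MVT_segment R (fun t : R => g t i 0) (fun t : R => dg t i 0) 0 1 ler01.
- by move=> t; rewrite in_itv /= => /andP[t0 t1]; apply: der; rewrite !ltW.
- apply: derivable_within_continuous => t; rewrite in_itv /= => /der.
  by case.
rewrite subr0 mulr1 !mxE => ->; rewrite in_itv /= in c01.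
exact: le_trans (abs_coord_le_enorm _ _ _ _) (hB _ c01).
Qed.

End MeanValue.

(** * Taylor remainders of the Jacobian and of the function at the root *)

Section Taylor.
Variables (R : realType) (n : nat).

Lemma line_close (xs e : 'cV[R]_n) (d : R) : 0 < d -> exists2 d' : R, 0 < d' &
  forall y t : R, `|y - t| < d' -> enorm (xs + y *: e - (xs + t *: e)) < d.
Proof.
move=> d0; have p : 0 < enorm e + 1 by rewrite ltr_wpDl ?enorm_ge0.
exists (d / (enorm e + 1)); first by rewrite divr_gt0.
move=> y t; rewrite ltr_pdivlMr // => h.
rewrite opprD addrACA subrr add0r -scalerBl enormZ; apply: le_lt_trans h.
by rewrite ler_wpM2l // lerDl.
Qed.

Lemma segment_in_ball (x xs : 'cV[R]_n) (d t : R) : 0 <= t <= 1 ->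
  enorm (x - xs) < d -> enorm (xs + t *: (x - xs) - xs) < d.
Proof.
move=> /andP[t0 t1]; apply: le_lt_trans.
by rewrite addrC addKr enormZ ger0_norm // ler_piMl ?enorm_ge0.
Qed.

(** Along the segment from [xs] to [x], subtracting the linear model leaves a curve [g] whose
    derivative is a difference of two Hessians, which the Lipschitz condition makes small. *)
Lemma jacobian_taylor (J : 'cV[R]_n -> 'M[R]_n) (H : 'cV[R]_n -> 'I_n -> 'M[R]_n)
    (xs : 'cV[R]_n) (d L : R) :
  (forall x, enorm (x - xs) < d -> hessian_at J (H x) x) ->
  (forall x y, enorm (x - xs) < d -> enorm (y - xs) < d ->
     forall u v, enorm (hessB (H y) u v - hessB (H x) u v)
                 <= L * enorm (y - x) * enorm u * enorm v) ->
  forall x v, enorm (x - xs) < d ->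
    enorm ((J x - J xs) *m v - hessB (H xs) (x - xs) v)
    <= n%:R * (`|L| * enorm (x - xs) ^+ 2 * enorm v).
Proof.
move=> hJ hL x v hx; set e := x - xs.
have d0 : 0 < d := le_lt_trans (enorm_ge0 _ _ _) hx.
pose g t := J (xs + t *: e) *m v - t *: hessB (H xs) e v.
pose dg t := hessB (H (xs + t *: e)) e v - hessB (H xs) e v.
have -> : (J x - J xs) *m v - hessB (H xs) e v = g 1 - g 0.
  rewrite /g !scale1r !scale0r addr0 subr0 [xs + e]addrC subrK mulmxBl.
  by rewrite addrAC.
apply: (@mean_value_ineq R n g dg) => t t01.
  move=> eps eps0.
  (* Adding 1 keeps the rescaled tolerance meaningful when [e] or [v] is zero. *)
  have p : 0 < enorm e * enorm v + 1.
    by rewrite ltr_wpDl // mulr_ge0 ?enorm_ge0.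
  have [||d1 d10 hd1] := hJ (xs + t *: e) _ (eps / (enorm e * enorm v + 1)).
  - exact: segment_in_ball.
  - by rewrite divr_gt0.
  have [d2 d20 hd2] := line_close xs e d1 d10.
  exists d2 => // y /hd2 /hd1 /(_ v).
  have E : xs + y *: e - (xs + t *: e) = (y - t) *: e.
    by rewrite opprD addrACA subrr add0r -scalerBl.
  rewrite E hessBZl enormZ /g /dg => hle.
  have -> : J (xs + y *: e) *m v - y *: hessB (H xs) e v
     - (J (xs + t *: e) *m v - t *: hessB (H xs) e v)
     - (y - t) *: (hessB (H (xs + t *: e)) e v - hessB (H xs) e v) =
     (J (xs + y *: e) - J (xs + t *: e)) *m v
       - (y - t) *: hessB (H (xs + t *: e)) e v.
    by apply/matrixP => i j; rewrite mulmxBl !mxE; ring.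
  apply: (le_trans hle).
  have -> : eps / (enorm e * enorm v + 1) * (`|y - t| * enorm e) * enorm v
     = eps * `|y - t| * ((enorm e * enorm v) / (enorm e * enorm v + 1)) by ring.
  apply: ler_piMr; first by rewrite mulr_ge0 // ltW.
  by rewrite ler_pdivrMr // mul1r lerDl.
have := hL xs (xs + t *: e) _ (segment_in_ball x xs d t t01 hx) e v.
rewrite subrr enorm0 => /(_ d0); move/le_trans; apply.
rewrite addrC addKr enormZ.
have /andP[t0 t1] := t01; rewrite ger0_norm //.
apply: ler_wpM2r; first exact: enorm_ge0.
(* The sign of [L] is unknown, so its absolute value is taken before [t] is bounded by 1. *)
apply: (@le_trans _ _ (`|L| * (t * enorm e) * enorm e)).
  by rewrite !ler_wpM2r ?mulr_ge0 ?enorm_ge0 ?ler_norm.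
rewrite -!mulrA ler_wpM2l // expr2.
by apply: ler_piMl => //; rewrite mulr_ge0 ?enorm_ge0.
Qed.

(** With the quadratic model subtracted, the derivative along the segment is the Jacobian remainder
    applied to [e], so one more integration gives the cubic bound. *)
Lemma function_taylor (f : 'cV[R]_n -> 'cV[R]_n) (J : 'cV[R]_n -> 'M[R]_n)
    (T : 'I_n -> 'M[R]_n) (xs : 'cV[R]_n) (d M : R) :
  0 <= M ->
  (forall x, enorm (x - xs) < d -> jacobian_at f (J x) x) ->
  (forall x v, enorm (x - xs) < d ->
     enorm ((J x - J xs) *m v - hessB T (x - xs) v)
     <= M * enorm (x - xs) ^+ 2 * enorm v) ->
  forall x, enorm (x - xs) < d ->
    enorm (f x - f xs - J xs *m (x - xs) - 2^-1 *: hessB T (x - xs) (x - xs))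
    <= n%:R * (M * enorm (x - xs) ^+ 3).
Proof.
move=> M0 hf hJ x hx; set e := x - xs; set h := hessB T e e.
pose g t := f (xs + t *: e) - t *: (J xs *m e) - (2^-1 * t ^+ 2) *: h.
pose dg t := (J (xs + t *: e) - J xs) *m e - t *: h.
have -> : f x - f xs - J xs *m e - 2^-1 *: h = g 1 - g 0.
  rewrite /g expr1n mulr1 expr0n mulr0 !scale1r !scale0r addr0 !subr0.
  rewrite [xs + e]addrC subrK.
  by apply/matrixP => i j; rewrite !mxE; ring.
apply: (@mean_value_ineq R n g dg) => t t01.
  move=> eps eps0.
  have p : 0 < enorm e + 1 by rewrite ltr_wpDl ?enorm_ge0.
  have ph : 0 < enorm h + 1 by rewrite ltr_wpDl ?enorm_ge0.
  have [||d1 d10 hd1] := hf (xs + t *: e) _ (eps / 2 / (enorm e + 1)).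
  - exact: segment_in_ball.
  - by rewrite !divr_gt0.
  have [d2 d20 hd2] := line_close xs e d1 d10.
  (* The first radius controls the differentiability error of [f], the second the leftover
     [(y - t)^2 / 2] multiple of [h]; each gets half of [eps]. *)
  exists (Num.min d2 (eps / (enorm h + 1))).
    by rewrite lt_min d20 divr_gt0.
  move=> y; rewrite lt_min => /andP[/hd2 /hd1 hle yh].
  have E : xs + y *: e - (xs + t *: e) = (y - t) *: e.
    by rewrite opprD addrACA subrr add0r -scalerBl.
  rewrite E enormZ -scalemxAr in hle.
  have -> : g y - g t - (y - t) *: dg t =
     (f (xs + y *: e) - f (xs + t *: e) - (y - t) *: (J (xs + t *: e) *m e))
     - (2^-1 * (y - t) ^+ 2) *: h.
    rewrite /g /dg mulmxBl.
    by apply/matrixP => i j; rewrite !mxE; field.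
  apply: (le_trans (enormB _ _ _ _)).
  rewrite [X in _ <= X](_ : _ = eps / 2 * `|y - t| + eps / 2 * `|y - t|); last by field.
  apply: lerD.
    apply: (le_trans hle).
    rewrite -!mulrA; apply: ler_wpM2l; first exact: ltW.
    rewrite ler_wpM2l ?invr_ge0 // mulrCA; apply: ler_piMr => //.
    by rewrite ler_pdivrMl // mulr1 lerDl.
  rewrite enormZ normrM normrX gtr0_norm ?invr_gt0 //.
  rewrite ltr_pdivlMr // in yh.
  have a0 := normr_ge0 (y - t); have h0 := enorm_ge0 _ _ h.
  by nra.
have := hJ (xs + t *: e) e (segment_in_ball x xs d t t01 hx).
have -> : xs + t *: e - xs = t *: e by rewrite addrC addKr.
rewrite hessBZl enormZ -/h => /le_trans; apply.
have /andP[t0 t1] := t01; rewrite ger0_norm // exprMn.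
have e0 : 0 <= enorm e := enorm_ge0 _ _ e.
have -> : M * (t ^+ 2 * enorm e ^+ 2) * enorm e = M * (t ^+ 2 * enorm e ^+ 3).
  by ring.
by rewrite ler_wpM2l // ler_piMl ?exprn_ge0 // exprn_ile1.
Qed.

End Taylor.

(** * Estimates for one Newton step in the wedge, with a single constant [C] *)

Section LocalEstimates.
Variables (R : realType) (n : nat) (f : 'cV[R]_n -> 'cV[R]_n).
Variables (J : 'cV[R]_n -> 'M[R]_n) (xs : 'cV[R]_n) (A PN : 'M[R]_n).
Variables (T : 'I_n -> 'M[R]_n) (C d : R).
Implicit Types u v x : 'cV[R]_n.
Hypothesis C_ge1 : 1 <= C.
Hypothesis PN_A : PN *m A = 0.
Hypothesis A_PN : A *m PN = 0.
Hypothesis PN_idem : PN *m PN = PN.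
Hypothesis PN_bound : forall v, enorm (PN *m v) <= C * enorm v.
Hypothesis PX_bound : forall v, enorm ((1%:M - PN) *m v) <= C * enorm (A *m v).
Hypothesis A_bound : forall v, enorm (A *m v) <= C * enorm v.
Hypothesis T_bound : forall u v, enorm (hessB T u v) <= C * enorm u * enorm v.
Hypothesis T_nondegenerate : forall u v,
  enorm (PN *m u) * enorm (PN *m v)
  <= C * enorm (PN *m hessB T (PN *m u) (PN *m v)).
Hypothesis J_expansion : forall x v, enorm (x - xs) < d ->
  enorm ((J x - A) *m v - hessB T (x - xs) v) <= C * enorm (x - xs) ^+ 2 * enorm v.
Hypothesis f_expansion : forall x, enorm (x - xs) < d ->
  enorm (f x - A *m (x - xs) - 2^-1 *: hessB T (x - xs) (x - xs))
  <= C * enorm (x - xs) ^+ 3.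

Local Notation a x := (PN *m (x - xs)).
Local Notation b x := ((1%:M - PN) *m (x - xs)).

Lemma mulmx_J_sub_A_bound x v : enorm (x - xs) < d -> enorm (x - xs) <= 1 ->
  enorm ((J x - A) *m v) <= 2 * C * enorm (x - xs) * enorm v.
Proof.
move=> hd h1; have hJ := J_expansion x v hd.
have := enormD _ _ ((J x - A) *m v - hessB T (x - xs) v) (hessB T (x - xs) v).
rewrite subrK => /le_trans; apply.
have hT := T_bound (x - xs) v.
have e0 := enorm_ge0 _ _ (x - xs); have v0 := enorm_ge0 _ _ v.
have : C * enorm (x - xs) ^+ 2 * enorm v <= C * enorm (x - xs) * enorm v.
  rewrite ler_wpM2r // ler_wpM2l ?(le_trans ler01) //.
  by rewrite expr2 ler_piMl.
lra.
Qed.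

(** On the range component [A] is already boundedly invertible ([PX_bound]), so [J x] acts as a
    small perturbation of [A] and no division by the error is needed. *)
Lemma PX_solution_bound x v :
  enorm (x - xs) < d -> enorm (x - xs) <= 1 ->
  enorm ((1%:M - PN) *m v)
  <= C * enorm (J x *m v) + 2 * C ^+ 2 * (enorm (x - xs) * enorm v).
Proof.
move=> hd h1; apply: (le_trans (PX_bound v)).
have -> : A *m v = J x *m v - (J x - A) *m v by rewrite mulmxBl opprB addrC subrK.
have hB := enormB _ _ (J x *m v) ((J x - A) *m v).
have hS := mulmx_J_sub_A_bound x v hd h1.
have -> : C * enorm (J x *m v) + 2 * C ^+ 2 * (enorm (x - xs) * enorm v) =
  C * (enorm (J x *m v) + 2 * C * enorm (x - xs) * enorm v) by ring.
by rewrite ler_wpM2l ?(le_trans ler01) // (le_trans hB) // lerD2l.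
Qed.

(** [PN] annihilates [A], so [PN *m J x] sees only the Hessian and the remainder. Splitting both
    Hessian arguments along N and X isolates the nondegenerate N-N block; the other blocks become
    error terms. *)
Lemma PN_solution_bound x v : enorm (x - xs) < d ->
  enorm (a x) * enorm (PN *m v) <=
    C ^+ 2 * (enorm (J x *m v) + C * enorm (x - xs) ^+ 2 * enorm v
      + C * enorm (a x) * enorm ((1%:M - PN) *m v) + C * enorm (b x) * enorm v).
Proof.
move=> hd; have C0 : 0 <= C := le_trans ler01 C_ge1.
apply: (le_trans (T_nondegenerate _ _)).
rewrite expr2 -mulrA ler_wpM2l //.
set e := x - xs; set q := (J x - A) *m v - hessB T e v.
have -> : PN *m hessB T (PN *m e) (PN *m v) =
  PN *m (J x *m v - q - hessB T (PN *m e) ((1%:M - PN) *m v)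
         - hessB T ((1%:M - PN) *m e) v).
  have -> : J x *m v - q = A *m v + hessB T e v.
    by rewrite /q mulmxBl !opprB addrCA [J x *m v + _]addrC subrK addrC.
  have -> : hessB T e v = hessB T (PN *m e) (PN *m v)
      + hessB T (PN *m e) ((1%:M - PN) *m v) + hessB T ((1%:M - PN) *m e) v.
    by rewrite -hessBDr PN_PX_split -hessBDl PN_PX_split.
  have -> (w1 w2 w3 w4 : 'cV[R]_n) : w1 + (w2 + w3 + w4) - w3 - w4 = w1 + w2.
    by apply/matrixP => i j; rewrite !mxE; ring.
  by rewrite [RHS]mulmxDr [X in X + _]mulmxA PN_A mul0mx add0r.
apply: (le_trans (PN_bound _)); rewrite ler_wpM2l //.
apply: (le_trans (enormB _ _ _ _)); apply: lerD; last exact: T_bound.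
apply: (le_trans (enormB _ _ _ _)); apply: lerD; last exact: T_bound.
apply: (le_trans (enormB _ _ _ _)); apply: lerD => //.
exact: J_expansion.
Qed.

Lemma enorm_le_2a x : enorm (b x) <= enorm (a x) ->
  enorm (x - xs) <= 2 * enorm (a x).
Proof.
move=> h; have := enormD _ _ (a x) (b x); rewrite PN_PX_split; lra.
Qed.

(* The component of the solution along the null space is only controlled after
   division by [enorm (x - xs)]: this is the singularity of the Newton step. *)
Lemma solution_bound x v (rho gam : R) :
  rho <= d -> 32 * C ^+ 6 * rho <= 1 -> 8 * C ^+ 6 * gam <= 1 ->
  enorm (x - xs) < rho -> enorm (b x) <= gam * enorm (a x) ->
  enorm (x - xs) * enorm v <= 10 * C ^+ 6 * enorm (J x *m v).
Proof.
move=> rd hr hg hx hb.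
have C0 : 0 <= C := le_trans ler01 C_ge1.
have C6 : 1 <= C ^+ 6 by rewrite exprn_ege1.
have e0 := enorm_ge0 _ _ (x - xs).
have r0 : 0 < rho := le_lt_trans e0 hx.
have hd := lt_le_trans hx rd.
have r1 : rho <= 1 by nra.
have e1 : enorm (x - xs) <= 1 := le_trans (ltW hx) r1.
have a0 := enorm_ge0 _ _ (a x).
have b0 := enorm_ge0 _ _ (b x).
have g1 : gam <= 1 by nra.
have ba : enorm (b x) <= enorm (a x) by rewrite (le_trans hb) // ler_piMl.
have ea := enorm_le_2a x ba.
have ae := PN_bound (x - xs).
have hP := PX_solution_bound x v hd e1.
have hN := PN_solution_bound x v hd.
have hv := enormD _ _ (PN *m v) ((1%:M - PN) *m v); rewrite PN_PX_split in hv.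
move: hP hN hv hb ba ea ae hx e1 hd.
have := enorm_ge0 _ _ v; have := enorm_ge0 _ _ (J x *m v).
have := enorm_ge0 _ _ (PN *m v); have := enorm_ge0 _ _ ((1%:M - PN) *m v).
move: e0 a0 b0.
set e := enorm (x - xs); set al := enorm (a x); set be := enorm (b x).
set p := enorm (PN *m v); set q := enorm ((1%:M - PN) *m v).
set V := enorm v; set r := enorm (J x *m v).
move=> e0 a0 b0 q0 p0 r'0 V0 hP hN hv hb ba ea ae hx e1 hd.
have powC k w : (k <= 6)%N -> 0 <= w -> C ^+ k * w <= C ^+ 6 * w.
  by move=> k6 w0; rewrite ler_wpM2r // ler_weXn2l.
have eV0 : 0 <= e * V by rewrite mulr_ge0.
have eq : e * q <= C * r + 2 * C ^+ 2 * (rho * (e * V)).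
  have h1 : e * q <= e * (C * r + 2 * C ^+ 2 * (e * V)) by rewrite ler_wpM2l.
  have h2 : e * (C * r) <= C * r by rewrite ler_piMl // mulr_ge0.
  have h3 : C ^+ 2 * (e * (e * V)) <= C ^+ 2 * (rho * (e * V)).
    by rewrite ler_wpM2l ?exprn_ge0 // ler_wpM2r // ltW.
  lra.
have ep : e * p <= 2 * C ^+ 2 * (r + C * (rho * (e * V)) + C ^+ 2 * (e * q)
                                 + C ^+ 2 * gam * (e * V)).
  have h1 : e * p <= 2 * (al * p) by rewrite mulrA ler_wpM2r.
  have h2 : C * (e * (e * V)) <= C * (rho * (e * V)).
    by rewrite ler_wpM2l // ler_wpM2r // ltW.
  have h3 : C * (al * q) <= C * ((C * e) * q) by rewrite ler_wpM2l // ler_wpM2r.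
  have h4 : C * (be * V) <= C * (gam * (C * e) * V).
    rewrite ler_wpM2l // ler_wpM2r //.
    (* No sign is assumed for [gam]; a negative value makes the wedge condition force [be], [al] and
       hence [e] to vanish. *)
    have [g0|g0] := leP 0 gam; first by rewrite (le_trans hb) // ler_wpM2l.
    have -> : be = 0 by apply/le_anti; rewrite b0 andbT; nra.
    have : al = 0 by apply/le_anti; rewrite a0 andbT; nra.
    move=> al0; have -> : e = 0 by apply/le_anti; rewrite e0 andbT; lra.
    by rewrite !mulr0.
  apply: (le_trans h1); rewrite -[2 * C ^+ 2 * _]mulrA ler_wpM2l //.
  apply: (le_trans hN); rewrite ler_wpM2l ?exprn_ge0 //; lra.
have reV0 : 0 <= rho * (e * V) by rewrite mulr_ge0 // ltW.
have k1 := powC 1%N r isT r'0.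
have k2 := powC 2%N r isT r'0.
have k5 := powC 5%N r isT r'0.
have l2 := powC 2%N _ isT reV0.
have l3 := powC 3%N _ isT reV0.
have s1 : C ^+ 4 * (e * q) <= C ^+ 5 * r + 2 * (C ^+ 6 * (rho * (e * V))).
  have : C ^+ 4 * (e * q) <= C ^+ 4 * (C * r + 2 * C ^+ 2 * (rho * (e * V))).
    by rewrite ler_wpM2l ?exprn_ge0.
  lra.
(* Adding the bounds on [e * p] and [e * q], with powers of [C] raised to the sixth, gives at most
   [5 C^6 r + 8 C^6 rho (e V) + 2 C^4 gam (e V)]. The constants 32 and 8 make each of the last two
   terms at most a quarter of [e V]; absorbing them doubles 5 to 10. *)
have s2 : C ^+ 6 * rho * (e * V) <= 32^-1 * (e * V).
  by rewrite ler_wpM2r //; lra.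
have s3 : C ^+ 4 * gam * (e * V) <= 8^-1 * (e * V).
  rewrite ler_wpM2r //.
  have [g0|g0] := leP 0 gam; first by have := powC 4%N gam isT g0; lra.
  by apply: (@le_trans _ _ 0); rewrite ?invr_ge0 // mulr_ge0_le0 ?exprn_ge0 // ltW.
have s4 : e * V <= e * p + e * q by rewrite -mulrDr ler_wpM2l.
lra.
Qed.

Lemma mulmx_A_PX v : A *m ((1%:M - PN) *m v) = A *m v.
Proof. by rewrite mulmxA mulmxBr mulmx1 A_PN subr0. Qed.

(** The linear term [A *m (x - xs)] depends only on the range component, hence first order in [b]
    but second order in the full error. *)
Lemma f_bound x : enorm (x - xs) < d -> enorm (x - xs) <= 1 ->
  enorm (f x) <= 2 * C * (enorm (b x) + enorm (x - xs) ^+ 2).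
Proof.
have C0 : 0 <= C := le_trans ler01 C_ge1.
move=> hd e1; have hf := f_expansion x hd; have hT := T_bound (x - xs) (x - xs).
have hA := A_bound (b x); rewrite mulmx_A_PX in hA.
set h := 2^-1 *: hessB T (x - xs) (x - xs) in hf.
have hh : enorm h <= 2^-1 * (C * enorm (x - xs) ^+ 2).
  by rewrite enormZ gtr0_norm ?invr_gt0 // ler_wpM2l ?invr_ge0 // expr2 mulrA.
have h1 := enormD _ _ (f x - A *m (x - xs) - h) (A *m (x - xs) + h).
have -> : f x = (f x - A *m (x - xs) - h) + (A *m (x - xs) + h).
  by rewrite -[f x - _ - _]addrA -opprD subrK.
have h2 := enormD _ _ (A *m (x - xs)) h.
have e0 := enorm_ge0 _ _ (x - xs); have b0 := enorm_ge0 _ _ (b x).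
have : C * enorm (x - xs) ^+ 3 <= C * enorm (x - xs) ^+ 2.
  by rewrite ler_wpM2l // exprSr ler_piMr // exprn_ge0.
have : 0 <= C * enorm (b x) by rewrite mulr_ge0.
have : 0 <= C * enorm (x - xs) ^+ 2 by rewrite mulr_ge0 ?exprn_ge0.
lra.
Qed.

(* Subtracting half of the null-space part of [x - xs] cancels both the linear
   and the quadratic terms of the Taylor expansion. *)
Lemma newton_residual_bound x xp (c : R) :
  enorm (x - xs) < d -> enorm (x - xs) <= 1 -> enorm (b x) <= enorm (a x) ->
  enorm (J x *m (xp - x) + f x) <= c * enorm (f x) ^+ 2 ->
  enorm (J x *m (xp - xs - 2^-1 *: a x))
  <= (8 * C ^+ 3 * `|c| + 2 * C) * (enorm (x - xs)
     * (enorm (b x) + enorm (x - xs) ^+ 2)).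
Proof.
move=> hd e1 ba ht.
have C0 : 0 <= C := le_trans ler01 C_ge1.
set t := J x *m (xp - x) + f x in ht.
set e := x - xs in hd e1 ba *.
set q1 := (J x - A) *m e - hessB T e e.
set q2 := f x - A *m e - 2^-1 *: hessB T e e.
set q3 := (J x - A) *m b x.
(* The vector is [(xp - x) + (e + b) / 2]. Here [J x (xp - x)] is [t - f x], and the terms
   [A e + H(e,e) / 2] of [f x] cancel against the main parts of [J x e / 2] and [J x b / 2], because
   [A b = A e]. *)
have -> : J x *m (xp - xs - 2^-1 *: (PN *m e)) = t - q2 + 2^-1 *: (q1 + q3).
  have -> : xp - xs - 2^-1 *: (PN *m e) = (xp - x) + 2^-1 *: (e + b x).
    have -> : xp - xs = (xp - x) + e by rewrite /e addrA subrK.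
    have -> : b x = e - PN *m e by rewrite mulmxBl mul1mx.
    have E (w1 w2 w3 : 'cV[R]_n) :
        w1 + w2 - 2^-1 *: w3 = w1 + 2^-1 *: (w2 + (w2 - w3)).
      by apply/matrixP => i j; rewrite !mxE; field.
    exact: E.
  have Eb : q3 = J x *m b x - A *m e by rewrite /q3 mulmxBl mulmx_A_PX.
  rewrite Eb /q1 /q2 /t [LHS]mulmxDr -scalemxAr [J x *m (e + _)]mulmxDr.
  rewrite [(J x - A) *m e]mulmxBl.
  have E (w1 w2 w3 w4 w5 w6 : 'cV[R]_n) : w1 + 2^-1 *: (w2 + w3) =
      w1 + w6 - (w6 - w4 - 2^-1 *: w5) + 2^-1 *: (w2 - w4 - w5 + (w3 - w4)).
    by apply/matrixP => i j; rewrite !mxE; field.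
  exact: E.
have hq1 : enorm q1 <= C * enorm e ^+ 2 * enorm e := J_expansion x e hd.
have hq2 : enorm q2 <= C * enorm e ^+ 3 := f_expansion x hd.
have hq3 : enorm q3 <= 2 * C * enorm e * enorm (b x) := mulmx_J_sub_A_bound x _ hd e1.
have hf : enorm (f x) <= 2 * C * (enorm (b x) + enorm e ^+ 2) := f_bound x hd e1.
have e0 := enorm_ge0 _ _ e; have b0 := enorm_ge0 _ _ (b x).
have f0 := enorm_ge0 _ _ (f x).
have ae : enorm (PN *m e) <= C * enorm e := PN_bound e.
set s := enorm (b x) + enorm e ^+ 2 in hf *.
have s0 : 0 <= s by rewrite addr_ge0 ?exprn_ge0.
(* Trading one factor [s] of the bound on [enorm (f x) ^+ 2] for [enorm e] puts the inexactness at
   the same order [enorm e * s] as the Taylor terms. *)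
have se : s <= 2 * C * enorm e.
  have : enorm e ^+ 2 <= C * enorm e.
    by rewrite expr2 ler_wpM2r // (le_trans e1).
  rewrite /s; lra.
have hff : enorm (f x) ^+ 2 <= 8 * C ^+ 3 * (enorm e * s).
  apply: (@le_trans _ _ ((2 * C * s) ^+ 2)).
    by rewrite ler_sqr ?nnegrE // !mulr_ge0.
  have -> : (2 * C * s) ^+ 2 = (4 * C ^+ 2 * s) * s by ring.
  have -> : 8 * C ^+ 3 * (enorm e * s) = (4 * C ^+ 2 * s) * (2 * C * enorm e) by ring.
  by rewrite ler_wpM2l // !mulr_ge0 ?exprn_ge0.
have htt : enorm t <= `|c| * (8 * C ^+ 3 * (enorm e * s)).
  apply: (le_trans ht); apply: (@le_trans _ _ (`|c| * enorm (f x) ^+ 2)).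
    by rewrite ler_wpM2r ?exprn_ge0 ?ler_norm.
  by rewrite ler_wpM2l.
have h1 := enormD _ _ (t - q2) (2^-1 *: (q1 + q3)).
have h2 := enormB _ _ t q2.
have h3 := enormD _ _ q1 q3.
rewrite enormZ gtr0_norm ?invr_gt0 // in h1.
have h4 : 0 <= C * (enorm e * enorm (b x)) by rewrite !mulr_ge0.
have h5 : 0 <= C * enorm e ^+ 3 by rewrite mulr_ge0 ?exprn_ge0.
apply: (le_trans h1); rewrite /s in htt *; lra.
Qed.

(** The residual carries a factor [enorm (x - xs)] that pays for the division in [solution_bound].
    The range component needs no division, so it keeps that factor and is one order smaller. *)
Lemma newton_step_bounds (c rho gam : R) :
  rho <= d -> 32 * C ^+ 6 * rho <= 1 -> 8 * C ^+ 6 * gam <= 1 ->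
  exists2 K : R, 1 <= K & forall x xp,
    0 < enorm (x - xs) < rho -> enorm (b x) <= gam * enorm (a x) ->
    enorm (J x *m (xp - x) + f x) <= c * enorm (f x) ^+ 2 ->
    enorm ((1%:M - PN) *m (xp - xs)) <= K * enorm (x - xs) ^+ 2 /\
    enorm (PN *m (xp - xs) - 2^-1 *: (PN *m (x - xs)))
      <= K * (enorm (b x) + enorm (x - xs) ^+ 2).
Proof.
move=> rd hr hg.
have C0 : 0 <= C := le_trans ler01 C_ge1.
have C6 : 1 <= C ^+ 6 by rewrite exprn_ege1.
pose N := 8 * C ^+ 3 * `|c| + 2 * C.
pose M := 10 * C ^+ 6.
have N0 : 0 <= N by rewrite addr_ge0 // !mulr_ge0 ?exprn_ge0.
have M0 : 0 <= M by rewrite mulr_ge0 ?exprn_ge0.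
pose K1 := (C * N + 2 * C ^+ 2 * (M * N)) * (2 * C).
pose K2 := C * (M * N).
have K10 : 0 <= K1.
  by rewrite /K1 mulr_ge0 ?addr_ge0 ?(mulr_ge0, exprn_ge0).
have K20 : 0 <= K2 by rewrite !mulr_ge0.
exists (1 + K1 + K2); first by rewrite -addrA lerDl addr_ge0.
move=> x xp /andP[e_gt0 hx] hb ht.
have r1 : rho <= 1 by nra.
have e1 : enorm (x - xs) <= 1 := le_trans (ltW hx) r1.
have hd := lt_le_trans hx rd.
have a0 := enorm_ge0 _ _ (a x).
have b0 := enorm_ge0 _ _ (b x).
have ba : enorm (b x) <= enorm (a x) by rewrite (le_trans hb) // ler_piMl //; nra.
have ae := PN_bound (x - xs).
set v := xp - xs - 2^-1 *: a x.
have PNv : PN *m (xp - xs) - 2^-1 *: a x = PN *m v.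
  by rewrite /v [RHS]mulmxBr -scalemxAr [PN *m (PN *m _)]mulmxA PN_idem.
have PXv : (1%:M - PN) *m (xp - xs) = (1%:M - PN) *m v.
  have PXPN : (1%:M - PN) *m PN = 0 by rewrite mulmxBl mul1mx PN_idem subrr.
  by rewrite /v [RHS]mulmxBr -scalemxAr [X in _ - _ *: X]mulmxA PXPN
             mul0mx scaler0 subr0.
have hr' : enorm (J x *m v) <= N * (enorm (x - xs) * (enorm (b x) + enorm (x - xs) ^+ 2)).
  exact: newton_residual_bound.
have hs := solution_bound x v rho gam rd hr hg hx hb.
have hP := PX_solution_bound x v hd e1.
rewrite PNv PXv; set s := enorm (b x) + enorm (x - xs) ^+ 2 in hr' *.
have s0 : 0 <= s by rewrite addr_ge0 ?exprn_ge0 ?enorm_ge0.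
have vs : enorm v <= M * N * s.
  rewrite -(ler_pM2l e_gt0) (le_trans hs) //.
  have -> : enorm (x - xs) * (M * N * s) = M * (N * (enorm (x - xs) * s)) by ring.
  by rewrite ler_wpM2l.
have se : s <= 2 * C * enorm (x - xs).
  have : enorm (x - xs) ^+ 2 <= C * enorm (x - xs).
    by rewrite expr2 ler_wpM2r ?(ltW e_gt0) // (le_trans e1).
  rewrite /s; lra.
split.
  apply: (@le_trans _ _ (K1 * enorm (x - xs) ^+ 2)); last first.
    by rewrite ler_wpM2r ?exprn_ge0 ?(ltW e_gt0) //; lra.
  apply: (le_trans hP).
  have -> : K1 * enorm (x - xs) ^+ 2 = (C * N + 2 * C ^+ 2 * (M * N)) *
      (enorm (x - xs) * (2 * C * enorm (x - xs))) by rewrite /K1; ring.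
  apply: (@le_trans _ _ ((C * N + 2 * C ^+ 2 * (M * N)) * (enorm (x - xs) * s))).
    rewrite [leRHS]mulrDl; apply: lerD.
      by rewrite -[leRHS]mulrA ler_wpM2l.
    have -> : 2 * C ^+ 2 * (M * N) * (enorm (x - xs) * s) =
      2 * C ^+ 2 * (enorm (x - xs) * (M * N * s)) by ring.
    by rewrite ler_wpM2l ?mulr_ge0 ?exprn_ge0 // ler_wpM2l // ltW.
  rewrite ler_wpM2l ?addr_ge0 ?(mulr_ge0, exprn_ge0) //.
  by rewrite ler_wpM2l // ltW.
apply: (@le_trans _ _ (K2 * s)); last by rewrite ler_wpM2r //; lra.
apply: (le_trans (PN_bound v)).
by rewrite /K2 -mulrA ler_wpM2l.
Qed.

(** The columns of the cokernel matrix are vectors killed by [J x], and [solution_bound] forces them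
    to be zero when the error is nonzero. *)
Lemma jacobian_unit x (rho gam : R) :
  rho <= d -> 32 * C ^+ 6 * rho <= 1 -> 8 * C ^+ 6 * gam <= 1 ->
  0 < enorm (x - xs) < rho -> enorm (b x) <= gam * enorm (a x) ->
  J x \in unitmx.
Proof.
move=> rd hr hg /andP[e_gt0 hx] hb; rewrite -row_full_unit -cokermx_eq0.
apply/eqP/matrixP => i j; rewrite [RHS]mxE.
have /eqP : enorm (col j (cokermx (J x))) = 0.
  apply/le_anti; rewrite enorm_ge0 andbT -(pmulr_rle0 _ e_gt0).
  have := solution_bound x (col j (cokermx (J x))) rho gam rd hr hg hx hb.
  by rewrite colE mulmxA mulmx_coker mul0mx enorm0 mulr0.
by rewrite enorm_eq0 => /eqP/colP/(_ i); rewrite !mxE.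
Qed.

End LocalEstimates.

(** * Algebra of the null space and range splitting *)

Section Splitting.
Variables (R : realType) (n : nat) (A PN : 'M[R]_n) (phi : 'cV[R]_n).
Hypothesis kerA : forall v, A *m v = 0 <-> exists a : R, v = a *: phi.
Hypothesis direct : forall (a : R) w, a *: phi = A *m w -> a *: phi = 0.
Hypothesis PN_proj : forall v,
  (exists a : R, PN *m v = a *: phi) /\ (exists w, v - PN *m v = A *m w).

Lemma mulmx_cV_inj (B B' : 'M[R]_n) :
  (forall v : 'cV[R]_n, B *m v = B' *m v) -> B = B'.
Proof.
move=> hB; apply/matrixP => i j; have := hB (delta_mx j 0).
by rewrite -!colE => /colP/(_ i); rewrite !mxE.
Qed.

Lemma PN_phi : PN *m phi = phi.
Proof.
have [[a Ea] [w]] := PN_proj phi; rewrite Ea.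
rewrite -{1}[phi]scale1r -scalerBl => /direct; rewrite scalerBl scale1r.
by move/eqP; rewrite subr_eq0 => /eqP.
Qed.

Lemma mulmx_PN_A : PN *m A = 0.
Proof.
apply: mulmx_cV_inj => w; rewrite mul0mx -mulmxA.
have [[a Ea] [w' Ew]] := PN_proj (A *m w); rewrite Ea in Ew *.
apply: (direct _ (w - w')); rewrite mulmxBr -Ew opprB addrC subrK //.
Qed.

Lemma mulmx_A_PN : A *m PN = 0.
Proof.
apply: mulmx_cV_inj => v; rewrite mul0mx -mulmxA; apply/kerA.
by have [] := PN_proj v.
Qed.

Lemma mulmx_PN_PN : PN *m PN = PN.
Proof.
apply: mulmx_cV_inj => v; rewrite -mulmxA; have [[a ->] _] := PN_proj v.
by rewrite -scalemxAr PN_phi.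
Qed.

(** [1%:M - PN] vanishes on the kernel of [A], so it factors through [A]. Boundedness of [D] then
    replaces an inverse of [A] restricted to X. *)
Lemma PX_factor : exists D : 'M[R]_n, 1%:M - PN = D *m A.
Proof.
apply/submxP; rewrite submxE; apply/eqP/matrixP => i j.
have /kerA[a Ea] : A *m col j (cokermx A) = 0.
  by rewrite colE mulmxA mulmx_coker mul0mx.
have : (1%:M - PN) *m col j (cokermx A) = 0.
  by rewrite Ea -scalemxAr mulmxBl mul1mx PN_phi subrr scaler0.
by rewrite colE mulmxA -colE => /colP/(_ i); rewrite !mxE.
Qed.

(** N is a line, so both sides scale with the product of the two coefficients along [phi]; with this
    constant the inequality is an equality. *)
Lemma hessB_nondegenerate (T : 'I_n -> 'M[R]_n) :
  PN *m hessB T phi phi != 0 ->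
  exists C : R, forall u v, enorm (PN *m u) * enorm (PN *m v)
    <= C * enorm (PN *m hessB T (PN *m u) (PN *m v)).
Proof.
move=> nz; exists (enorm phi ^+ 2 / enorm (PN *m hessB T phi phi)) => u v.
have [[a ->] _] := PN_proj u; have [[a' ->] _] := PN_proj v.
rewrite hessBZl hessBZr -!scalemxAr !enormZ le_eqVlt; apply/orP; left.
by apply/eqP; field; rewrite enorm_eq0.
Qed.

End Splitting.

(** * Invariance of the wedge and convergence of the error sequence *)

Section WedgeDynamics.
Variables (R : realType) (n : nat) (PN : 'M[R]_n) (K rho gam : R).
Hypotheses (K_ge1 : 1 <= K) (gam_gt0 : 0 < gam) (gam_small : 16 * K * gam <= 1).
Hypothesis rho_small : 8 * K * rho <= gam.
Implicit Types e : 'cV[R]_n.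

Local Notation a e := (enorm (PN *m e)).
Local Notation b e := (enorm ((1%:M - PN) *m e)).

Definition in_wedge e := 0 < enorm e < rho /\ b e <= gam * a e.

(** Only the outcome of [newton_step_bounds] is retained, so the dynamics concern an arbitrary
    sequence of error vectors. *)
Definition half_step e e' := b e' <= K * enorm e ^+ 2 /\
  enorm (PN *m e' - 2^-1 *: (PN *m e)) <= K * (b e + enorm e ^+ 2).

Lemma enorm_split e : enorm e <= a e + b e.
Proof. by have := enormD _ _ (PN *m e) ((1%:M - PN) *m e); rewrite PN_PX_split. Qed.

Lemma gam_le : 16 * gam <= 1.
Proof. by have := gam_gt0; have := K_ge1; have := gam_small; nra. Qed.

Lemma in_wedge_enorm_le e : in_wedge e -> enorm e <= 2 * a e.
Proof.
move=> [_ hb]; have := enorm_split e; have a0 := enorm_ge0 _ _ (PN *m e).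
have : gam * a e <= 1 * a e by rewrite ler_wpM2r //; have := gam_le; lra.
lra.
Qed.

Lemma half_step_wedge e e' : in_wedge e -> half_step e e' ->
  [/\ in_wedge e', enorm e' <= 14 / 15 * enorm e & enorm e <= 8 * a e'].
Proof.
move=> We [hb' ha']; have ea := in_wedge_enorm_le e We.
case: (We) => /andP[e0 er] hb.
have a0 := enorm_ge0 _ _ (PN *m e); have b0 := enorm_ge0 _ _ ((1%:M - PN) *m e).
have g1 := gam_le; have gs := gam_small; have rs := rho_small.
have K0 : 0 <= K := le_trans ler01 K_ge1.
have Kb : K * b e <= 16^-1 * a e.
  have : K * b e <= K * (gam * a e) by rewrite ler_wpM2l.
  have : (K * gam) * a e <= 16^-1 * a e by rewrite ler_wpM2r //; lra.
  lra.
have Ke2 : K * enorm e ^+ 2 <= 8^-1 * gam * enorm e.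
  rewrite expr2 mulrA ler_wpM2r ?(ltW e0) //.
  have : K * enorm e <= K * rho by rewrite ler_wpM2l // ltW.
  lra.
have ge : gam * enorm e <= 16^-1 * enorm e by rewrite ler_wpM2r ?(ltW e0) //; lra.
have ga : gam * a e <= 16^-1 * a e by rewrite ler_wpM2r //; lra.
have hd := enorm_distD _ _ (PN *m e') (2^-1 *: (PN *m e)).
rewrite enormZ [`|2^-1|]gtr0_norm ?invr_gt0 // in hd.
(* The deviation is at most [a / 16 + a / 64], well below [a / 4]; thus the new null-space part lies
   between [a / 4] and [3 a / 4]. *)
have /andP[hd1 hd2] : - (a e / 4) <= a e' - 2^-1 * a e <= a e / 4.
  rewrite -ler_norml (le_trans hd) // (le_trans ha') //; lra.
have sp := enorm_split e'.
have ae : a e <= enorm e + b e.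
  have -> : PN *m e = e - (1%:M - PN) *m e by rewrite mulmxBl mul1mx opprB addrC subrK.
  exact: enormB.
have ea' : enorm e <= 8 * a e' by lra.
(* From [a e <= 16/15 * enorm e] the null-space part is at most 4/5 of the old error, and the range
   part adds at most 1/128. *)
have e'le : enorm e' <= 14 / 15 * enorm e by lra.
split=> //; split; last first.
  (* The 8 here cancels the 1/8 in [Ke2], which gives back exactly the slope [gam]. *)
  have : gam * enorm e <= gam * (8 * a e') by rewrite ler_wpM2l // ltW.
  lra.
apply/andP; split; last by lra.
rewrite lt_def enorm_ge0 andbT enorm_eq0; apply/eqP => e'0.
by move: ea'; rewrite e'0 mulmx0 enorm0; lra.
Qed.

Variable e : nat -> 'cV[R]_n.
Hypothesis e_start : in_wedge (e 0%N).
Hypothesis e_step : forall j, in_wedge (e j) -> half_step (e j) (e j.+1).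

Lemma orbit_in_wedge j : in_wedge (e j).
Proof. by elim: j => // j IH; have [] := half_step_wedge _ _ IH (e_step j IH). Qed.

Lemma orbit_decay j : enorm (e j) <= geometric rho (14 / 15) j.
Proof.
rewrite /geometric /=; elim: j => [|j IH].
  by rewrite expr0 mulr1; case: e_start => /andP[_ /ltW].
have W := orbit_in_wedge j; have [_ h _] := half_step_wedge _ _ W (e_step j W).
by apply: (le_trans h); rewrite exprS mulrCA ler_wpM2l //; lra.
Qed.

Lemma orbit_cvg0 : enorm (e j) @[j --> \oo] --> (0 : R).
Proof.
apply: (@squeeze_cvgr _ _ _ _ (fun=> 0) (geometric rho (14 / 15))).
- by near=> j; rewrite enorm_ge0 orbit_decay.
- exact: cvg_cst.
by apply: cvg_geometric; rewrite ger0_norm; lra.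
Unshelve. all: by end_near.
Qed.

(** The ratio starts at index [j.+1] because only after one step is the range part quadratically
    small. Comparing with [a (e j.+1)], which is at least an eighth of [enorm (e j)], leaves one
    factor [enorm (e j)]. *)
Lemma orbit_ratio_bound j :
  `|a (e j.+2) / a (e j.+1) - 2^-1| <= 2 * K * (4 * K + 1) * enorm (e j).
Proof.
have W := orbit_in_wedge j; have W1 := orbit_in_wedge j.+1.
have [hb' _] := e_step j W; have [_ ha] := e_step j.+1 W1.
have [_ e'e ea] := half_step_wedge _ _ W (e_step j W).
have ea1 := in_wedge_enorm_le _ W1.
have e0 : 0 < enorm (e j) by case: W => /andP[].
have e10 := enorm_ge0 _ _ (e j.+1).
have a0 : 0 < a (e j.+1) by lra.
have -> : a (e j.+2) / a (e j.+1) - 2^-1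
    = (a (e j.+2) - 2^-1 * a (e j.+1)) / a (e j.+1) by field; rewrite gt_eqF.
rewrite normrM [`|_^-1|]gtr0_norm ?invr_gt0 // ler_pdivrMr //.
have hd := enorm_distD _ _ (PN *m e j.+2) (2^-1 *: (PN *m e j.+1)).
rewrite enormZ [`|2^-1|]gtr0_norm ?invr_gt0 // in hd.
apply: (le_trans hd); apply: (le_trans ha).
have K0 : 0 <= K := le_trans ler01 K_ge1.
have -> : 2 * K * (4 * K + 1) * enorm (e j) * a (e j.+1) =
  K * (K * enorm (e j) * (8 * a (e j.+1)) + enorm (e j) * (2 * a (e j.+1))) by ring.
rewrite ler_wpM2l //; apply: lerD.
  by rewrite (le_trans hb') // expr2 mulrA ler_wpM2l // mulr_ge0 // ltW.
by rewrite expr2 ler_pM //; lra.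
Qed.

Lemma orbit_ratio_cvg : a (e j.+1) / a (e j) @[j --> \oo] --> (2^-1 : R).
Proof.
rewrite -cvg_shiftS; apply/subr_cvg0/norm_cvg0P.
apply: (@squeeze_cvgr _ _ _ _ (fun=> 0)
  (fun j => 2 * K * (4 * K + 1) * enorm (e j))).
- by near=> j; rewrite normr_ge0 orbit_ratio_bound.
- exact: cvg_cst.
rewrite -[X in _ --> X](mulr0 (2 * K * (4 * K + 1))).
by apply: cvgM; [exact: cvg_cst|exact: orbit_cvg0].
Unshelve. all: by end_near.
Qed.

End WedgeDynamics.

(** * Choice of constants and assembly of the convergence theorem *)

Theorem theorem5p2 (R : realType) (n : nat)
  (f : 'cV[R]_n -> 'cV[R]_n) (J : 'cV[R]_n -> 'M[R]_n)
  (H : 'cV[R]_n -> 'I_n -> 'M[R]_n) (xs phi : 'cV[R]_n) (PN : 'M[R]_n) :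
  f xs = 0 ->
  (* f twice Lipschitz continuously differentiable near xs, with Jacobian J
     and Hessian H *)
  (exists2 d : R, 0 < d &
     (forall x, enorm (x - xs) < d -> jacobian_at f (J x) x /\ hessian_at J (H x) x)
     /\ (exists L : R, forall x y, enorm (x - xs) < d -> enorm (y - xs) < d ->
           forall u v, enorm (hessB (H y) u v - hessB (H x) u v)
                       <= L * enorm (y - x) * enorm u * enorm v)) ->
  (* null space of J(xs) is N = span{phi}, one-dimensional *)
  phi != 0 ->
  (forall v, J xs *m v = 0 <-> exists a : R, v = a *: phi) ->
  (* R^n = N (+) X, X = range of J(xs) *)
  (forall v, exists a w, v = a *: phi + J xs *m w) ->
  (forall (a : R) w, a *: phi = J xs *m w -> a *: phi = 0) ->
  (* PN is the projection onto N parallel to X *)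
  (forall v, (exists a : R, PN *m v = a *: phi) /\ (exists w, v - PN *m v = J xs *m w)) ->
  PN *m hessB (H xs) phi phi != 0 ->
  (* nonsingularity of Dbar_1(x) on N *)
  (forall x z, PN *m (x - xs) != 0 -> (exists a : R, z = a *: phi) ->
     PN *m hessB (H xs) (PN *m (x - xs)) (PN *m z) = 0 -> z = 0) ->
  forall c : R,
  exists rho0 gam0 : R, 0 < rho0 /\ 0 < gam0 /\
  forall rho gam : R, 0 < rho <= rho0 -> 0 < gam <= gam0 ->
    (forall x0, inW xs PN rho gam x0 -> J x0 \in unitmx) /\
    exists2 K1 : R, 0 < K1 &
      forall (x : nat -> 'cV[R]_n) (nj : nat -> nat)
             (Pm Vm : forall j : nat, 'M[R]_(n, nj j)),
        inW xs PN rho gam (x 0%N) ->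
        (forall j, nlkrylov_step f (Pm j) (Vm j) (x j) (x j.+1)) ->
        (forall j, enorm (J (x j) *m (x j.+1 - x j) + f (x j))
                   <= c * enorm (f (x j)) ^+ 2) ->
        (x @ \oo --> xs) /\
        (forall j, enorm ((1%:M - PN) *m (x j.+1 - xs)) <= K1 * enorm (x j - xs) ^+ 2) /\
        ((fun j => enorm (PN *m (x j.+1 - xs)) / enorm (PN *m (x j - xs)))
           @ \oo --> (2^-1 : R)).

Proof.
move=> fxs [d d0 [hder [L hL]]] phi0 kerJ _ direct projPN nondeg _ c.
have PNA := mulmx_PN_A _ _ _ _ _ direct projPN.
have APN := mulmx_A_PN _ _ _ _ _ kerJ projPN.
have PNPN := mulmx_PN_PN _ _ _ _ _ direct projPN.
have [D PXE] := PX_factor _ _ _ _ _ kerJ direct projPN.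
have [C1 hC1] := mulmx_bounded _ _ PN.
have [C2 hC2] := mulmx_bounded _ _ D.
have [C3 hC3] := mulmx_bounded _ _ (J xs).
have [C4 hC4] := hessB_bounded _ _ (H xs).
have [C5 hC5] := hessB_nondegenerate _ _ _ _ _ projPN (H xs) nondeg.
have hJ := jacobian_taylor _ _ J H xs d L (fun x hx => (hder x hx).2) hL.
pose C6 : R := n%:R * `|L|.
have hJ6 x v : enorm (x - xs) < d ->
    enorm ((J x - J xs) *m v - hessB (H xs) (x - xs) v)
    <= C6 * enorm (x - xs) ^+ 2 * enorm v.
  by move=> hx; have := hJ x v hx; rewrite /C6 !mulrA.
have C60 : 0 <= C6 by rewrite mulr_ge0.
have hf := function_taylor _ _ f J (H xs) xs d C6 C60
  (fun x hx => (hder x hx).1) hJ6.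
(* A sum of nonnegative terms dominates every individual constant and is at least 1. *)
pose C : R := 1 + `|C1| + `|C2| + `|C3| + `|C4| + `|C5| + C6 + n%:R * C6.
have n0 : (0 : R) <= n%:R by rewrite ler0n.
have nC60 : 0 <= n%:R * C6 by rewrite mulr_ge0.
have a1 := ler_norm C1; have a2 := ler_norm C2; have a3 := ler_norm C3.
have a4 := ler_norm C4; have a5 := ler_norm C5.
have b1 := normr_ge0 C1; have b2 := normr_ge0 C2; have b3 := normr_ge0 C3.
have b4 := normr_ge0 C4; have b5 := normr_ge0 C5.
have C_ge1 : 1 <= C by rewrite /C; lra.
have PN_bound v : enorm (PN *m v) <= C * enorm v.
  by apply: (le_trans (hC1 v)); rewrite ler_wpM2r ?enorm_ge0 // /C; lra.
have PX_bound v : enorm ((1%:M - PN) *m v) <= C * enorm (J xs *m v).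
  rewrite PXE -mulmxA; apply: (le_trans (hC2 _)).
  by rewrite ler_wpM2r ?enorm_ge0 // /C; lra.
have A_bound v : enorm (J xs *m v) <= C * enorm v.
  by apply: (le_trans (hC3 v)); rewrite ler_wpM2r ?enorm_ge0 // /C; lra.
have T_bound u v : enorm (hessB (H xs) u v) <= C * enorm u * enorm v.
  apply: (le_trans (hC4 u v)); rewrite ler_wpM2r ?enorm_ge0 //.
  by rewrite ler_wpM2r ?enorm_ge0 // /C; lra.
have T_nondeg u v : enorm (PN *m u) * enorm (PN *m v)
    <= C * enorm (PN *m hessB (H xs) (PN *m u) (PN *m v)).
  by apply: (le_trans (hC5 u v)); rewrite ler_wpM2r ?enorm_ge0 // /C; lra.
have J_exp x v : enorm (x - xs) < d ->
    enorm ((J x - J xs) *m v - hessB (H xs) (x - xs) v)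
    <= C * enorm (x - xs) ^+ 2 * enorm v.
  move=> /hJ6 h; apply: (le_trans (h v)); rewrite ler_wpM2r ?enorm_ge0 //.
  by rewrite ler_wpM2r ?exprn_ge0 ?enorm_ge0 // /C; lra.
have f_exp x : enorm (x - xs) < d ->
    enorm (f x - J xs *m (x - xs) - 2^-1 *: hessB (H xs) (x - xs) (x - xs))
    <= C * enorm (x - xs) ^+ 3.
  move=> /hf; rewrite fxs subr0 mulrA => h; apply: (le_trans h).
  by rewrite ler_wpM2r ?exprn_ge0 ?enorm_ge0 // /C; lra.
have C6pos : 0 < C ^+ 6 by rewrite exprn_gt0 // (lt_le_trans ltr01).
pose rho1 := Num.min d (32 * C ^+ 6)^-1.
pose gam1 := (8 * C ^+ 6)^-1.
have rho1d : rho1 <= d by rewrite ge_min lexx.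
have rho10 : 0 < rho1 by rewrite lt_min d0 invr_gt0 mulr_gt0.
have rho1C : 32 * C ^+ 6 * rho1 <= 1.
  by rewrite -ler_pdivlMl ?(mulr_gt0 _ C6pos) // [_^-1 * 1]mulr1 ge_min lexx orbT.
have gam1C : 8 * C ^+ 6 * gam1 <= 1 by rewrite divff // gt_eqF // mulr_gt0.
have gam10 : 0 < gam1 by rewrite invr_gt0 mulr_gt0.
have [K K1 hstep] := newton_step_bounds _ _ f J xs (J xs) PN (H xs) C d C_ge1 PNA APN
  PNPN PN_bound PX_bound A_bound T_bound T_nondeg J_exp f_exp c rho1 gam1
  rho1d rho1C gam1C.
have K0 : 0 < K := lt_le_trans ltr01 K1.
(* [K] is fixed from [rho1] and [gam1] first; the wedge can then be shrunk until it is invariant,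
   without circularity. *)
pose gam0 := Num.min gam1 (16 * K)^-1.
pose rho0 := Num.min rho1 (gam0 / (8 * K)).
have gam00 : 0 < gam0 by rewrite lt_min gam10 invr_gt0 mulr_gt0.
have gamK : 16 * K * gam0 <= 1.
  by rewrite -ler_pdivlMl ?(mulr_gt0 _ K0) // [_^-1 * 1]mulr1 ge_min lexx orbT.
have rhoK : 8 * K * rho0 <= gam0.
  by rewrite -ler_pdivlMl ?(mulr_gt0 _ K0) // [leRHS]mulrC ge_min lexx orbT.
have rho00 : 0 < rho0 by rewrite lt_min rho10 divr_gt0 // mulr_gt0.
exists rho0, gam0; split=> //; split=> //.
move=> rho gam /andP[_ rhole] /andP[_ gamle].
(* Any smaller starting wedge lies in the [rho0], [gam0] wedge, where the whole orbit is followed;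
   hence one [K] serves all [rho] and [gam]. *)
have inW_wedge x : inW xs PN rho gam x -> in_wedge R n PN rho0 gam0 (x - xs).
  move=> [/andP[x0 xr] hb]; split; first by rewrite x0 (lt_le_trans xr).
  by rewrite (le_trans hb) // ler_wpM2r ?enorm_ge0.
have wedge1 x : in_wedge R n PN rho0 gam0 (x - xs) ->
    0 < enorm (x - xs) < rho1 /\
    enorm ((1%:M - PN) *m (x - xs)) <= gam1 * enorm (PN *m (x - xs)).
  move=> [/andP[x0 xr] hb]; split.
    by rewrite x0 (lt_le_trans xr) // ge_min lexx.
  by rewrite (le_trans hb) // ler_wpM2r ?enorm_ge0 // ge_min lexx.
split.
  move=> x0 /inW_wedge/wedge1[hx hb].
  exact: (jacobian_unit _ _ J xs (J xs) PN (H xs) C d C_ge1 PNA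
    PN_bound PX_bound T_bound T_nondeg J_exp x0 rho1 gam1
    rho1d rho1C gam1C hx hb).
exists K => // x nj Pm Vm x0W _ ht.
have step j : in_wedge R n PN rho0 gam0 (x j - xs) ->
    half_step R n PN K (x j - xs) (x j.+1 - xs).
  by move=> /wedge1[hx hb]; exact: hstep.
pose e j := x j - xs.
have e0W : in_wedge R n PN rho0 gam0 (e 0%N) by exact: inW_wedge.
have eW := orbit_in_wedge R n PN K rho0 gam0 K1 gam00 gamK rhoK e e0W step.
have e0 := orbit_cvg0 R n PN K rho0 gam0 K1 gam00 gamK rhoK e e0W step.
split; last split.
(* Balls of column vectors are entrywise, and each entry is bounded by the Euclidean norm. *)
- apply/cvg_ballP => eps eps0; near=> j; split=> // i k; rewrite ord1.
  have := abs_coord_le_enorm _ _ (e j) i; rewrite !mxE => h.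
  rewrite -ball_normE /= distrC (le_lt_trans h) //.
  rewrite -[enorm _]ger0_norm ?enorm_ge0 //.
  by near: j; apply: (cvgr0_norm_lt _ e0).
- by move=> j; have [] := step j (eW j).
- exact: (orbit_ratio_cvg R n PN K rho0 gam0 K1 gam00 gamK rhoK e e0W step).
Unshelve. all: by end_near.
Qed.
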